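(* Let $0<k_\beta<k$ be integers, and let $\{P_{n,\theta}:\theta\in\mathbb{R}^k\}$, $n=1,2,\ldots$, be a sequence of statistical experiments on measurable spaces $(\mathcal{X}_n,\mathfrak{X}_n)$, with $\theta$ partitioned as $\theta=(\alpha',\beta')'$, $\alpha\in\mathbb{R}^{k-k_\beta}$, $\beta\in\mathbb{R}^{k_\beta}$. Suppose that for some $\alpha\in\mathbb{R}^{k-k_\beta}$ the sequence $P_{n,(\alpha',\gamma'/\sqrt n)'}$ is contiguous with respect to $P_{n,(\alpha',0)'}$ for every $\gamma\in\mathbb{R}^{k_\beta}$; fix this $\alpha$. Let $\hat\theta_n=(\hat\alpha_n',\hat\beta_n')'$ be an estimator sequence that is partially sparse, i.e. for every $\theta=(\bar\alpha',\beta')'\in\mathbb{R}^k$ and $i=1,\ldots,k_\beta$, $\lim_{n\to\infty}P_{n,\theta}(\hat\beta_{n,i}=0)=1$ whenever $\beta_i=0$. Suppose that there exists a $(k-k_\beta)\times k_\beta$ matrix $D$ such that for every $\gamma\in\mathbb{R}^{k_\beta}$ the random vector $n^{1/2}(\hat\alpha_n-\alpha)$ converges in $P_{n,(\alpha',\gamma'/\sqrt n)'}$-distribution to $Z+D\gamma$, where $Z$ is a $(k-k_\beta)\times1$ random vector with a distribution that is independent of $\gamma$ (i.e. does not depend on $\gamma$). Let $A$ be a $q\times k$ matrix of full row rank, partitioned conformably with $\theta$ as $A=(A_1,A_2)$ (so $A_1$ is $q\times(k-k_\beta)$ and $A_2$ is $q\times k_\beta$), and assume that $A_1D-A_2\ne0$.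 Let $C_n$ be a sequence of random sets in $\mathbb{R}^q$ based on $A\hat\theta_n$, in the sense that $P_{n,\theta}(A\hat\theta_n\in C_n)=1$ for all $\theta\in\mathbb{R}^k$. Assume that $C_n$ is a confidence set for $A\theta$ with asymptotic infimal coverage probability $\delta$, i.e. $$\delta=\liminf_{n\to\infty}\inf_{\theta\in\mathbb{R}^k}P_{n,\theta}(A\theta\in C_n).$$ Then for every $t\ge0$, $$\liminf_{n\to\infty}\sup_{\theta\in\mathbb{R}^k}P_{n,\theta}\left(\sqrt n\,\operatorname{diam}(C_n)\ge t\right)\ge\delta .$$ (If the set inside the probability in the last display is not measurable, the probability is to be replaced by inner probability.)
   Context: For each $n$, every $P_{n,\theta}$ is a probability measure on $(\mathcal{X}_n,\mathfrak{X}_n)$; a prime denotes transpose. Contiguity: a sequence $Q_n$ of probability measures is contiguous with respect to $P_n$ if for all measurable $E_n\in\mathfrak{X}_n$, $P_n(E_n)\to0$ implies $Q_n(E_n)\to0$. Convergence of random vectors $X_n$ on $\mathcal{X}_n$ in $P_{n,\theta_n}$-distribution means weak convergence of the laws of $X_n$ under $P_{n,\theta_n}$. Estimator: $\hat\theta_n$ is a measurable function $\mathcal{X}_n\to\mathbb{R}^k$; $\hat\beta_{n,i}$ and $\beta_i$ denote the $i$-th components of $\hat\beta_n$ and $\beta$. Random set in $\mathbb{R}^q$: $C_n=C_n(\omega)$ is a subset of $\mathbb{R}^q$ for every $\omega\in\mathcal{X}_n$ such that for every $\vartheta\in\mathbb{R}^q$ the set $\{\omega\in\mathcal{X}_n:\vartheta\in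 C_n(\omega)\}$ belongs to $\mathfrak{X}_n$. In the condition $P_{n,\theta}(A\hat\theta_n\in C_n)=1$ the probability is replaced by inner probability if the event is not measurable. $\operatorname{diam}(B)=\sup\{\|x-y\|:x\in B,\,y\in B\}$ (possibly $+\infty$), with $\|\cdot\|$ the Euclidean norm. *)

(* Defs.v *)
From HB Require Import structures.
From mathcomp Require Import all_boot all_order all_algebra.
From mathcomp Require Import all_classical all_reals all_analysis.
Set Implicit Arguments.
Unset Strict Implicit.
Unset Printing Implicit Defensive.
Import Order.TTheory GRing.Theory Num.Theory.
Import numFieldNormedType.Exports.
Local Open Scope classical_set_scope.
Local Open Scope ring_scope.

(* The matrix types carry no measurable structure in the library, hence the
   Borel sigma-algebra is attached to a copy of 'cV[R]_m. *)
Definition borel_cV (R : realType) (m : nat) :=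
  g_sigma_algebraType (@open 'cV[R]_m).

Definition random_vector (R : realType) (d : measure_display)
    (T : measurableType d) (m : nat) (X : T -> 'cV[R]_m) : Prop :=
  measurable_fun [set: T] (X : T -> borel_cV R m).

Definition random_set (R : realType) (d : measure_display)
    (T : measurableType d) (q : nat) (C : T -> set 'cV[R]_q) : Prop :=
  forall v : 'cV[R]_q, measurable [set w | C w v].

(* Agrees with [P E] whenever [E] is measurable. *)
Definition inner_prob (R : realType) (d : measure_display)
    (T : measurableType d) (P : probability T R) (E : set T) : \bar R :=
  ereal_sup [set P F | F in [set F | measurable F /\ F `<=` E]].

(* The canonical norm of the library on 'cV[R]_m is the sup norm. *)
Definition euclid_norm (R : realType) (m : nat) (x : 'cV[R]_m) : R :=
  Num.sqrt (\sum_(i < m) x i 0 ^+ 2).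

(* [diam set0 = -oo], the supremum of the empty set in [\bar R]. *)
Definition diam (R : realType) (m : nat) (B : set 'cV[R]_m) : \bar R :=
  ereal_sup [set (euclid_norm (x - y))%:E | x in B & y in B].

Definition contiguous (R : realType) (d : nat -> measure_display)
    (T : forall n, measurableType (d n))
    (Q P : forall n, probability (T n) R) : Prop :=
  forall E : (forall n, set (T n)), (forall n, measurable (E n)) ->
    P n (E n) @[n --> \oo] --> 0%E -> Q n (E n) @[n --> \oo] --> 0%E.

(* Weak convergence of the laws of [X n] under [P n] to the law of [Y] under
   [mu]; the [X n] may live on different probability spaces. *)
Definition cvg_in_distribution (R : realType) (m : nat)
    (d : nat -> measure_display) (T : forall n, measurableType (d n))
    (P : forall n, probability (T n) R) (X : forall n, T n -> 'cV[R]_m)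
    (d' : measure_display) (Omega : measurableType d')
    (mu : probability Omega R) (Y : Omega -> 'cV[R]_m) : Prop :=
  forall f : 'cV[R]_m -> R, continuous f -> bounded_fun f ->
    ('E_(P n)[f \o X n])%E @[n --> \oo] --> ('E_mu[f \o Y])%E.

(* [theta] is stacked as [col_mx alpha beta]. *)
Definition partially_sparse (R : realType) (ka kb : nat)
    (d : nat -> measure_display) (T : forall n, measurableType (d n))
    (P : forall n, 'cV[R]_(ka + kb) -> probability (T n) R)
    (thetahat : forall n, T n -> 'cV[R]_(ka + kb)) : Prop :=
  forall (theta : 'cV[R]_(ka + kb)) (i : 'I_kb), dsubmx theta i 0 = 0 ->
    P n theta [set w | dsubmx (thetahat n w) i 0 = 0] @[n --> \oo] --> 1%E.

(* Main.v *)
Require Import Defs.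
From HB Require Import structures.
From mathcomp Require Import all_boot all_order all_algebra.
From mathcomp Require Import all_classical all_reals all_analysis.
From mathcomp Require Import measurable_realfun.
Set Implicit Arguments.
Unset Strict Implicit.
Unset Printing Implicit Defensive.
Import Order.TTheory GRing.Theory Num.Theory.
Import numFieldNormedType.Exports.
Local Open Scope classical_set_scope.
Local Open Scope ring_scope.

(** Test the coverage at the local alternatives theta_n = (alpha, gamma / sqrt n).
  At gamma = 0 sparsity makes betahat_n vanish with probability tending to one,
  and contiguity carries this over to every gamma
  ([sparse_block_contiguous]). So under theta_n the estimator is blind to
  gamma: up to a negligible event,
    sqrt n (A thetahat_n - A theta_n)
      = A1 sqrt n (alphahat_n - alpha) - A2 gamma,
  which converges in law to A1 Z + (A1 D - A2) gamma. Some entry (i, j) of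
  A1 D - A2 is nonzero, hence with gamma = N e_j the i-th coordinate of this
  limit is (A1 Z)_i plus a nonzero multiple of N, and it escapes from [-t, t] as
  N grows ([expectation_bump_shift_cvg0]).

  Now C_n almost surely contains A thetahat_n. Whenever it also covers
  A theta_n, its diameter is at least the distance of these two points, which
  is at least t / sqrt n outside the events just shown to be improbable. This is
  the finite-sample inequality [coverage_le_diam]. Its error terms are
  eventually below any given e > 0 once N is large, so the minimal coverage
  probability is eventually at most e plus the supremum in the conclusion, and
  [limn_einf_le_near] passes to the lower limits.

  Only weak convergence is given, so the events |.| < t are handled through a
  continuous function, [bump], that dominates their indicators. *)

(** * Lower limits and inner probability *)

Lemma limn_einf_le_near (R : realType) (u v : (\bar R)^nat) :
  (forall e : R, 0 < e -> \forall n \near \oo, (u n <= e%:E + v n)%E) ->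
  (limn_einf u <= limn_einf v)%E.
Proof.
move=> uv; apply/lee_addgt0Pr => e e0.
rewrite addeC -limn_einf_shift// !limn_einf_lim.
apply: lee_lim; [exact: is_cvg_einfs|exact: is_cvg_einfs|].
have [N _ uvN] := uv e e0; exists N => // n /= Nn.
apply: le_ereal_inf_tmp => _ [k /= nk <-].
apply: le_trans (uvN k _); last exact: leq_trans Nn nk.
by apply: ereal_inf_lbound; exists k.
Qed.

Lemma cvge_lt (R : realType) (u : (\bar R)^nat) (l b : \bar R) :
  (l < b)%E -> u n @[n --> \oo] --> l -> \forall n \near \oo, (u n < b)%E.
Proof. by move=> lb ul; exact: (ul _ (open_ereal_lt' lb)). Qed.

(** The inner probability of E only sees measurable subsets of E. The event G of
  inner probability one need not be measurable, so it is replaced by a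
  measurable F inside it with P F > 1 - e; then S \cap F \ B is measurable and
  inside E, and S exceeds it by at most B and the complement of F. *)
Lemma probability_le_inner_prob (R : realType) (d : measure_display)
    (T : measurableType d) (P : probability T R) (S G B E : set T) :
  measurable S -> measurable B -> inner_prob P G = 1%E ->
  S `&` G `\` B `<=` E -> (P S <= inner_prob P E + P B)%E.
Proof.
move=> mS mB PG1 sub.
apply/lee_addgt0Pr => e e0.
have [_ [F [mF FG] <-] Fe] : exists2 x,
    [set P F | F in [set F | measurable F /\ F `<=` G]] x & (1 - e%:E < x)%E.
  apply: ereal_sup_gt; rewrite -/(inner_prob P G) PG1 lteBlDr// -EFinD lte_fin.
  by rewrite ltrDl.
have mSFB : measurable (S `&` F `\` B).
  by apply: measurableD => //; exact: measurableI.
have PSFB : (P (S `&` F `\` B) <= inner_prob P E)%E.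
  apply: ereal_sup_ubound; exists (S `&` F `\` B) => //; split => //.
  by move=> w [[Sw Fw] Bw]; apply: sub; split=> //; split => //; exact: FG.
have PFC : (P (~` F) <= e%:E)%E.
  rewrite probability_setC// leeBlDr ?fin_num_measure//.
  by rewrite -leeBlDl ?fin_num_measure// ltW.
apply: (@le_trans _ _ (P ((S `&` F `\` B) `|` B `|` ~` F))).
  apply: le_measure; rewrite ?inE//.
    by apply: measurableU; [exact: measurableU|exact: measurableC].
  move=> w Sw; have [Fw|Fw] := pselect (F w); last by right.
  by left; have [Bw|Bw] := pselect (B w); [right|left].
apply: le_trans (measureU2 _ _ _) _; [exact: measurableU|exact: measurableC|].
apply: leeD => //; apply: le_trans (measureU2 _ _ _) _ => //.
exact: leeD.
Qed.

(** * Random vectors and their coordinates *)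

Lemma continuous_random_vector (R : realType) (d : measure_display)
    (T : measurableType d) (m : nat) (X : T -> 'cV[R]_m) (f : 'cV[R]_m -> R) :
  random_vector X -> continuous f -> measurable_fun [set: T] (f \o X).
Proof.
move=> mX /continuousP cf.
apply: (measurability _ (RGenOpens.measurableE R)).
move=> _ [_ [a [b ->]] <-]; rewrite comp_preimage.
by apply: mX => //; apply: sub_sigma_algebra; exact/cf/interval_open.
Qed.

Lemma mulmx_coord_continuous (R : realType) (q m : nat) (M : 'M[R]_(q, m))
    (i : 'I_q) : continuous (fun x : 'cV[R]_m => (M *m x) i 0).
Proof.
move=> x; under eq_fun do rewrite mxE.
apply: (cvg_big (F := nbhs x) add_continuous) => j _.
by apply: cvgMl_tmp; exact: coord_continuous.
Qed.

Lemma abs_coord_le_euclid_norm (R : realType) (m : nat) (x : 'cV[R]_m) (i : 'I_m) :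
  `|x i 0| <= euclid_norm x.
Proof.
rewrite -sqrtr_sqr ler_wsqrtr// (bigD1 i)//= lerDl sumr_ge0// => j _.
exact: sqr_ge0.
Qed.

Lemma measurable_coord_neq0 (R : realType) (d : measure_display)
    (T : measurableType d) (m : nat) (X : T -> 'cV[R]_m) (i : 'I_m) :
  random_vector X -> measurable [set w | X w i 0 != 0].
Proof.
move=> mX; have mXi : measurable_fun [set: T] (fun w => X w i 0).
  exact: (continuous_random_vector mX (@coord_continuous R m 1 i 0)).
rewrite (_ : [set w | _] = setT `&` (fun w => X w i 0) @^-1` (~` [set 0])).
  by apply: mXi => //; apply: measurableC; exact: measurable_set1.
by rewrite setTI; apply/seteqP; split => w /= /eqP.
Qed.

Lemma dsubmx_neq0E (R : realType) (T : Type) (ka kb : nat)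
    (X : T -> 'cV[R]_(ka + kb)) :
  [set w | dsubmx (X w) != 0] =
  \bigcup_(i in [set: 'I_kb]) [set w | X w (rshift ka i) 0 != 0].
Proof.
apply/seteqP; split => w /=.
  move=> Xw; apply: contrapT => /forall2NP h; move/eqP: Xw; apply.
  apply/colP => i; rewrite !mxE; apply/eqP/negPn/negP => Xwi.
  by case: (h i); exact.
by move=> [i _]; apply: contra_neq => /colP/(_ i); rewrite !mxE.
Qed.

Lemma measurable_dsubmx_neq0 (R : realType) (d : measure_display)
    (T : measurableType d) (ka kb : nat) (X : T -> 'cV[R]_(ka + kb)) :
  random_vector X -> measurable [set w | dsubmx (X w) != 0].
Proof.
move=> mX; rewrite dsubmx_neq0E.
apply: fin_bigcup_measurable; first exact: finite_finset.
by move=> i _; exact: measurable_coord_neq0.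
Qed.

(** * A continuous majorant of the indicator of an interval *)

(** The trapezoid equal to 1 on [-t, t] and to 0 outside ]-t - 1, t + 1[, with
  affine sides. *)
Definition bump (R : realType) (t r : R) : R := Num.max 0 (Num.min 1 (t + 1 - `|r|)).

Section bump.
Variable R : realType.
Implicit Types t r : R.

Lemma bump_ge0 t r : 0 <= bump t r.
Proof. by rewrite /bump le_max lexx. Qed.

Lemma bump_le1 t r : bump t r <= 1.
Proof. by rewrite /bump ge_max ler01 ge_min lexx. Qed.

Lemma bump_eq1 t r : `|r| <= t -> bump t r = 1.
Proof.
move=> rt; rewrite /bump min_l ?max_r//.
by rewrite addrAC lerDr subr_ge0.
Qed.

Lemma bump_eq0 t r : t + 1 <= `|r| -> bump t r = 0.
Proof. by move=> rt; rewrite /bump max_l// ge_min subr_le0 rt orbT. Qed.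

Lemma bump_continuous t : continuous (bump t).
Proof.
move=> r; apply: (@continuous_max R _ (cst 0) (cst 1 \min (fun x => t + 1 - `|x|))).
  exact: cst_continuous.
apply: (@continuous_min R _ (cst 1) (fun x => t + 1 - `|x|)).
  exact: cst_continuous.
by apply: cvgB; [exact: cvg_cst|exact: norm_continuous].
Qed.

End bump.

Lemma bump_mulmx_coord_continuous (R : realType) (q m : nat) (M : 'M[R]_(q, m))
    (i : 'I_q) (t k : R) :
  continuous (fun x : 'cV[R]_m => bump t ((M *m x) i 0 - k)).
Proof.
move=> x.
apply: (@continuous_comp _ _ _ (fun y : 'cV[R]_m => (M *m y) i 0)
  (fun r => bump t (r - k))); first exact: mulmx_coord_continuous.
apply: continuous_comp; last exact: bump_continuous.
by apply: cvgB; [exact: cvg_id|exact: cvg_cst].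
Qed.

(** For each fixed w the argument Y w + N c leaves the support of the bump, so the
  integrands tend to 0 pointwise, dominated by the constant 1. *)
Lemma expectation_bump_shift_cvg0 (R : realType) (d : measure_display)
    (T : measurableType d) (mu : probability T R) (Y : T -> R) (c t : R) :
  measurable_fun [set: T] Y -> c != 0 ->
  ('E_mu[fun w => bump t (Y w + N%:R * c)])%E @[N --> \oo] --> 0%E.
Proof.
move=> mY c0; rewrite unlock.
rewrite -[X in _ --> X](integral0 mu [set: T]).
apply: (@dominated_cvg _ _ _ mu [set: T] _ _ _ (cst 1%E)) => //.
- move=> N; apply/measurable_EFinP.
  apply: (measurableT_comp (continuous_measurable_fun (@bump_continuous _ t))).
  exact: measurable_funD.
- move=> w _.
  apply: cvg_near_cst.
  near=> N; congr EFin; apply: bump_eq0.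
  have : (t + 1 + `|Y w|) / `|c| <= N%:R.
    by near: N; exact: nbhs_infty_ger.
  rewrite ler_pdivrMr ?normr_gt0// => h.
  rewrite [Y w + _]addrC; apply: le_trans (lerB_normD _ _).
  by rewrite normrM normr_nat lerBrDr.
- exact: finite_measure_integrable_cst.
- by move=> N w _ /=; rewrite lee_fin ger0_norm ?bump_ge0// bump_le1.
Unshelve. all: by end_near. Qed.

Lemma measurable_abs_lt (R : realType) (d : measure_display)
    (T : measurableType d) (Y : T -> R) (t : R) :
  measurable_fun [set: T] Y -> measurable [set w | `|Y w| < t].
Proof.
move=> mY; rewrite -[X in measurable X]setTI.
have mf : measurable_fun [set: T] (fun w => `|Y w| < t).
  by apply: measurable_fun_ltr => //; exact: measurableT_comp.
exact: (mf measurableT [set true]).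
Qed.

Lemma probability_lt_le_expectation_bump (R : realType) (d : measure_display)
    (T : measurableType d) (P : probability T R) (Y : T -> R) (t : R) :
  measurable_fun [set: T] Y ->
  (P [set w | (`|Y w| < t)%R] <= 'E_P[fun w => bump t (Y w)])%E.
Proof.
move=> mY.
have mE : measurable [set w | `|Y w| < t] by exact: measurable_abs_lt.
rewrite unlock -[X in P X]setIT -integral_indic//.
apply: ge0_le_integral => //.
- exact/measurable_EFinP/measurable_indic.
- apply/measurable_EFinP.
  exact: (measurableT_comp (continuous_measurable_fun (@bump_continuous _ t))).
- move=> w _; rewrite lee_fin indicE.
  have [/set_mem/= /ltW wt|_] := boolP (w \in _).
    by rewrite bump_eq1.
  exact: bump_ge0.
Qed.

(** * The estimator under local alternatives *)

(** Under P_{n,(alpha, 0)} each of the finitely many components of betahat_n is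
  nonzero with probability tending to 0; contiguity turns this into the same
  statement under Q_n, and the union bound collects the components. *)
Lemma sparse_block_contiguous (R : realType) (ka kb : nat)
    (d : nat -> measure_display) (T : forall n, measurableType (d n))
    (P : forall n, 'cV[R]_(ka + kb) -> probability (T n) R)
    (thetahat : forall n, T n -> 'cV[R]_(ka + kb)) (alpha : 'cV[R]_ka)
    (Q : forall n, probability (T n) R) :
  (forall n, (0 < n)%N -> random_vector (thetahat n)) ->
  partially_sparse P thetahat ->
  contiguous Q (fun n => P n (col_mx alpha 0)) ->
  Q n [set w | dsubmx (thetahat n w) != 0] @[n --> \oo] --> 0%E.
Proof.
move=> mth sparse contig.
(* Contiguity requires events that are measurable for every n, while the
   estimator is only measurable for n > 0. *)
pose E (i : 'I_kb) n : set (T n) :=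
  if n is 0 then set0 else [set w | thetahat n w (rshift ka i) 0 != 0].
have mE i n : measurable (E i n).
  by case: n => [|n] //=; apply: measurable_coord_neq0; exact: mth.
have QE i : Q n (E i n) @[n --> \oo] --> 0%E.
  apply: contig => //.
  have := sparse (col_mx alpha 0) i; rewrite col_mxKd mxE => /(_ erefl) h.
  rewrite -(@subee _ 1%E)//; apply: cvg_trans (cvgeB _ (cvg_cst 1%E) h) => //.
  apply: near_eq_cvg; exists 1%N => // -[//|n] _.
  rewrite [X in P _ _ X](_ : _ = ~` E i n.+1).
    by rewrite -probability_setC ?setCK//; exact: measurableC.
  apply/seteqP; split => w /=; rewrite mxE; first by move=> ->; rewrite eqxx.
  by move/negP/negPn/eqP.
have QsumE : (\sum_(i < kb) Q n (E i n))%E @[n --> \oo] --> 0%E.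
  rewrite [X in _ --> X](_ : _ = \sum_(i < kb) 0)%E; last by rewrite big1.
  apply: cvg_nnesum => i _; last exact: QE.
  exact: nearW.
apply: (squeeze_cvge _ (cvg_cst 0%E) QsumE).
exists 1%N => // -[//|n] _ /=; rewrite measure_ge0/=.
rewrite fsbig_seq ?index_enum_uniq//.
apply: content_sub_fsum => //.
- by move=> i _; exact: (mE i n.+1).
- by apply: measurable_dsubmx_neq0; exact: mth.
- rewrite dsubmx_neq0E => w [i _ Ei]; exists i => //=.
  by rewrite mem_index_enum.
Qed.

(** If C contains both A X and A theta, where theta = (alpha, gamma / s), then
  s * diam C is at least the modulus of the i-th coordinate of
  s (A X - A theta); and where the lower block of X vanishes, this coordinate
  is the difference inside the bump. *)
Lemma coverage_le_diam (R : realType) (ka kb q : nat) (d : measure_display)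
    (T : measurableType d) (P : probability T R) (X : T -> 'cV[R]_(ka + kb))
    (A : 'M[R]_(q, ka + kb)) (C : T -> set 'cV[R]_q)
    (alpha : 'cV[R]_ka) (gamma : 'cV[R]_kb) (s t : R) (i : 'I_q) :
  0 < s -> random_vector X -> random_set C ->
  inner_prob P [set w | C w (A *m X w)] = 1%E ->
  (P [set w | C w (A *m col_mx alpha (s^-1 *: gamma))] <=
   inner_prob P [set w | t%:E <= s%:E * diam (C w)] +
   (P [set w | (dsubmx (X w) != 0)%R] +
    'E_P[fun w => bump t ((lsubmx A *m (s *: (usubmx (X w) - alpha))) i 0 -
                          (rsubmx A *m gamma) i 0)%R]))%E.
Proof.
move=> s0 mX mC PC1.
pose theta := col_mx alpha (s^-1 *: gamma).
pose Y w := (lsubmx A *m (s *: (usubmx (X w) - alpha))) i 0 -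
            (rsubmx A *m gamma) i 0.
have mY : measurable_fun [set: T] Y.
  have -> : Y = fun w => s * (row_mx (lsubmx A) 0 *m X w) i 0 -
      (s * (lsubmx A *m alpha) i 0 + (rsubmx A *m gamma) i 0).
    apply/funext => w; rewrite -[X w in RHS]vsubmxK mul_row_col mul0mx addr0.
    rewrite /Y -scalemxAr mulmxBr; move: (lsubmx A *m usubmx (X w)) => u.
    move: (lsubmx A *m alpha) (rsubmx A *m gamma) => a b.
    by rewrite !mxE mulrBr opprD addrA.
  apply: measurable_funB => //; apply: measurable_funM => //.
  exact: continuous_random_vector mX (@mulmx_coord_continuous _ _ _ _ i).
have mB0 : measurable [set w | dsubmx (X w) != 0].
  exact: measurable_dsubmx_neq0.
have mBt : measurable [set w | `|Y w| < t] by exact: measurable_abs_lt.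
apply: (@le_trans _ _ (inner_prob P [set w | (t%:E <= s%:E * diam (C w))%E] +
    P ([set w | (dsubmx (X w) != 0)%R] `|` [set w | (`|Y w| < t)%R]))%E); last first.
  rewrite leeD2l//; apply: le_trans (measureU2 _ _ _) _ => //.
  by rewrite leeD2l//; exact: probability_lt_le_expectation_bump.
apply: probability_le_inner_prob PC1 _ => //; first exact: measurableU.
move=> w [[Cw CXw]] /not_orP[/negP/negPn/eqP Xw0 /negP].
rewrite -leNgt => /= tY.
have YE : Y w = s * (A *m X w - A *m theta) i 0.
  rewrite -mulmxBr -[A in RHS]hsubmxK -[X w in RHS]vsubmxK opp_col_mx.
  rewrite add_col_mx mul_row_col.
  rewrite Xw0 sub0r /Y -!scalemxAr mulmxN -scalemxAr.
  move: (lsubmx A *m _) (rsubmx A *m gamma) => u v.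
  by rewrite !mxE mulrDr mulrN mulrA divff ?gt_eqF// mul1r.
apply: (@le_trans _ _ (s%:E * (euclid_norm (A *m X w - A *m theta))%:E)%E);
    last first.
  rewrite lee_pmul2l ?lte_fin//.
  by apply: ereal_sup_ubound; exists (A *m X w) => //; exists (A *m theta).
rewrite -EFinM lee_fin (le_trans tY)// YE normrM gtr0_norm// ler_wpM2l ?(ltW s0)//.
exact: abs_coord_le_euclid_norm.
Qed.

(** * Diameters of confidence sets based on a sparse estimator *)

Theorem theorem10 (R : realType) (ka kb q : nat)
  (ka_gt0 : (0 < ka)%N) (kb_gt0 : (0 < kb)%N)
  (d : nat -> measure_display) (T : forall n, measurableType (d n))
  (P : forall n, 'cV[R]_(ka + kb) -> probability (T n) R)
  (alpha : 'cV[R]_ka)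
  (contig : forall gamma : 'cV[R]_kb,
    contiguous (fun n => P n (col_mx alpha ((Num.sqrt n%:R)^-1 *: gamma)))
               (fun n => P n (col_mx alpha 0)))
  (thetahat : forall n, T n -> 'cV[R]_(ka + kb))
  (thetahat_meas : forall n, (0 < n)%N -> random_vector (thetahat n))
  (sparse : partially_sparse P thetahat)
  (D : 'M[R]_(ka, kb))
  (d' : measure_display) (Omega : measurableType d')
  (mu : probability Omega R) (Z : Omega -> 'cV[R]_ka)
  (Z_meas : random_vector Z)
  (alphahat_cvg : forall gamma : 'cV[R]_kb,
    cvg_in_distribution
      (fun n => P n (col_mx alpha ((Num.sqrt n%:R)^-1 *: gamma)))
      (fun n w => Num.sqrt n%:R *: (usubmx (thetahat n w) - alpha))
      mu (fun z => Z z + D *m gamma))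
  (A : 'M[R]_(q, ka + kb)) (A_full_rank : row_free A)
  (A_neq0 : lsubmx A *m D - rsubmx A != 0)
  (C : forall n, T n -> set 'cV[R]_q)
  (C_random_set : forall n, (0 < n)%N -> random_set (C n))
  (C_based : forall n, (0 < n)%N -> forall theta : 'cV[R]_(ka + kb),
    inner_prob (P n theta) [set w | C n w (A *m thetahat n w)] = 1%E)
  (delta : R)
  (coverage : delta%:E = limn_einf (fun n =>
    ereal_inf [set P n theta [set w | C n w (A *m theta)]
              | theta in [set: 'cV[R]_(ka + kb)]]))
  (t : R) (t_ge0 : 0 <= t) :
  (delta%:E <= limn_einf (fun n =>
    ereal_sup [set inner_prob (P n theta)
                 [set w | t%:E <= (Num.sqrt n%:R)%:E * diam (C n w)]
              | theta in [set: 'cV[R]_(ka + kb)]]))%E.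
Proof.
rewrite coverage; apply: limn_einf_le_near => e e0.
have [i [j Mij]] : exists i j, (lsubmx A *m D - rsubmx A) i j != 0.
  apply: contrapT => /forallNP h; move/eqP: A_neq0; apply.
  apply/matrixP => i j; rewrite [RHS]mxE.
  by move/forallNP: (h i) => /(_ j)/negP/negPn/eqP.
set c := (lsubmx A *m D - rsubmx A) i j in Mij.
have mY : measurable_fun [set: Omega] (fun w => (lsubmx A *m Z w) i 0).
  exact: (continuous_random_vector Z_meas
    (@mulmx_coord_continuous _ _ _ (lsubmx A) i)).
have e2 : (0 < (e / 2)%:E)%E by rewrite lte_fin divr_gt0.
(* N is chosen before n: it makes the limiting probability small, and only then
   is the convergence in n used, for the resulting fixed gamma. *)
have [N _ /(_ N (leqnn N))/= EN] :=
  cvge_lt e2 (expectation_bump_shift_cvg0 mu t mY Mij).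
pose gamma : 'cV[R]_kb := N%:R *: delta_mx j 0.
pose theta n : 'cV[R]_(ka + kb) := col_mx alpha ((Num.sqrt n%:R)^-1 *: gamma).
pose f (x : 'cV[R]_ka) :=
  bump t ((lsubmx A *m x) i 0 - (rsubmx A *m gamma) i 0).
have cf : continuous f by exact: bump_mulmx_coord_continuous.
have bf : bounded_fun f.
  exists 1; split => // M M1 x _.
  by rewrite /= ger0_norm ?bump_ge0// (le_trans (bump_le1 _ _))// ltW.
have fZ : (fun w => bump t ((lsubmx A *m Z w) i 0 + N%:R * c)) =
    f \o (fun w => Z w + D *m gamma).
  apply/funext => w; rewrite /f /=; congr bump.
  rewrite mulmxDr [X in _ = X - _]mxE -addrA mulmxA; congr (_ + _).
  transitivity (((lsubmx A *m D - rsubmx A) *m gamma) i 0).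
    by rewrite /gamma -scalemxAr -colE 2!mxE.
  by rewrite mulmxBl mxE [X in _ + X]mxE.
rewrite fZ in EN.
have Ef := cvge_lt EN (alphahat_cvg gamma f cf bf).
have PB := cvge_lt e2 (sparse_block_contiguous (Q := fun n => P n (theta n))
  thetahat_meas sparse (contig gamma)).
near=> n.
have n0 : (0 < n)%N by near: n; exact: nbhs_infty_gt.
have s0 : 0 < Num.sqrt n%:R :> R by rewrite sqrtr_gt0 ltr0n.
apply: (@le_trans _ _ (P n (theta n) [set w | C n w (A *m theta n)])).
  by apply: ereal_inf_lbound; exists (theta n).
apply: le_trans (coverage_le_diam alpha gamma t i s0 (thetahat_meas n n0)
  (C_random_set n n0) (C_based n n0 (theta n))) _.
rewrite addeC; apply: leeD.
  rewrite [e]splitr EFinD; apply: leeD; apply: ltW; near: n.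
    exact: PB.
  exact: Ef.
by apply: ereal_sup_ubound; exists (theta n).
Unshelve. all: by end_near. Qed.
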